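(* Let $1\le m<n$ and $E\subseteq\mathbb{R}^n$. Suppose there is a computable martingale $d$ on $[0,1)^{n-m}$ such that the set \[N_E(d)=\{\mathbf{y}\in[0,1)^m:\ \exists\,\mathbf{x}\in (E^\#)_{\mathbf{y}}\text{ such that } d \text{ does not succeed at }\mathbf{x}\}\] has computable measure $0$ (as a subset of $\mathbb{R}^m$). Then $E$ has computable measure $0$.
   Context: For a set $A\subseteq\mathbb{R}^n$ and $\mathbf{y}=(y_1,\dots,y_m)\in\mathbb{R}^m$, $A_{\mathbf{y}}=\{(x_1,\dots,x_{n-m})\in\mathbb{R}^{n-m}:(x_1,\dots,x_{n-m},y_1,\dots,y_m)\in A\}$. In dimension $k\ge1$: for $r\in\mathbb{N}$, $\mathbf{u}\in\mathbb{Z}^k$, $Q_r(\mathbf{u})=\prod_{i=1}^k[u_i2^{-r},(u_i+1)2^{-r})$; $\mathcal{Q}_r=\{Q_r(\mathbf{u}):\mathbf{u}\in\{0,\dots,2^r-1\}^k\}$, $\mathcal{Q}=\bigcup_r\mathcal{Q}_r$. A martingale on $[0,1)^k$ is $d:\mathcal{Q}\to[0,\infty)$ with $d(Q_r(\mathbf{u}))=2^{-k}\sum_{\mathbf{a}\in\{0,1\}^k}d(Q_{r+1}(2\mathbf{u}+\mathbf{a}))$. For $\mathbf{x}\in[0,1)^k$, $d^{(r)}(\mathbf{x})=d(Q)$ for the $Q\in\mathcal{Q}_r$ containing $\mathbf{x}$; $d$ succeeds at $\mathbf{x}$ if $\limsup_rd^{(r)}(\mathbf{x})=\infty$. With $J=\{(r,\mathbf{u}):\mathbf{u}\in\{0,\dots,2^r-1\}^k\}$,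 $d$ is computable if there is a computable $\widehat d:\mathbb{N}\times J\to\mathbb{Q}\cap[0,\infty)$ with $|\widehat d(s,r,\mathbf{u})-d(Q_r(\mathbf{u}))|\le2^{-s}$ for all $(s,r,\mathbf{u})$. For $E\subseteq\mathbb{R}^k$, $E^\#=[0,1)^k\cap\bigcup_{\mathbf{t}\in\mathbb{Z}^k}(E+\mathbf{t})$, and $E$ has computable measure $0$ if some computable martingale on $[0,1)^k$ succeeds at every point of $E^\#$. *)

(* Defs.v *)
From HB Require Import structures.
From mathcomp Require Import all_boot all_order all_algebra.
From mathcomp Require Import all_classical all_reals all_analysis.

Set Implicit Arguments.
Unset Strict Implicit.
Unset Printing Implicit Defensive.

Import Order.TTheory GRing.Theory Num.Theory.
Local Open Scope classical_set_scope.
Local Open Scope ring_scope.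

(* Kleene's partial recursive functions: [recfun j] is the type of programs for
   partial functions N^j -> N, and [evaluates f v y] says that f halts on v with
   value y. *)
Inductive recfun : nat -> Type :=
| RZero : recfun 0
| RSucc : recfun 1
| RProj j of 'I_j : recfun j
| RComp j l of recfun l & ('I_l -> recfun j) : recfun j
| RPrec j of recfun j & recfun j.+2 : recfun j.+1
| RMin j of recfun j.+1 : recfun j.

(* In [RPrec f g] the recursion variable is the first argument; g receives the
   predecessor, then the previous value, then the parameters. [RMin f] searches
   on the first argument of f, which must halt at every smaller argument. *)
Fixpoint evaluates j (f : recfun j) : j.-tuple nat -> nat -> Prop :=
  match f in recfun j return j.-tuple nat -> nat -> Prop with
  | RZero => fun _ y => y = 0%N
  | RSucc => fun v y => y = (thead v).+1
  | RProj _ i => fun v y => y = tnth v i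
  | RComp _ l f g => fun v y =>
      exists w : l.-tuple nat,
        (forall i, evaluates (g i) v (tnth w i)) /\ evaluates f w y
  | RPrec _ f g => fun v =>
      (fix loop (c : nat) : nat -> Prop :=
        match c with
        | 0 => evaluates f (behead_tuple v)
        | c'.+1 => fun y => exists2 z, loop c' z &
            evaluates g [tuple of c' :: z :: behead_tuple v] y
        end) (thead v)
  | RMin _ f => fun v y =>
      evaluates f [tuple of y :: v] 0%N /\
      forall z, (z < y)%N -> exists t, evaluates f [tuple of z :: v] t.+1
  end.

Section Martingales.
Context {R : realType}.

Definition unit_cube k : set 'rV[R]_k := [set x | forall i, 0 <= x 0 i < 1].

Definition cube k (r : nat) (u : 'rV[int]_k) : set 'rV[R]_k :=
  [set x | forall i,
    (u 0 i)%:~R * 2 ^- r <= x 0 i < (u 0 i + 1)%:~R * 2 ^- r].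

Definition box k (r : nat) : set 'rV[int]_k :=
  [set u | forall i, 0 <= u 0 i < 2 ^+ r].

Definition cubes_at k (r : nat) : set (set 'rV[R]_k) := cube r @` box r.

Definition cubes k : set (set 'rV[R]_k) := \bigcup_r cubes_at r.

Definition child k (u : 'rV[int]_k) (a : 'rV[bool]_k) : 'rV[int]_k :=
  \row_i (2 * u 0 i + (a 0 i : nat)%:Z).

(* A function on the dyadic cubes is a total function on sets of points whose
   values outside [cubes] are never looked at. *)
Definition martingale k (d : set 'rV[R]_k -> R) : Prop :=
  (forall Q, cubes Q -> 0 <= d Q) /\
  (forall r u, box r u ->
     d (cube r u) = 2 ^- k * \sum_(a : 'rV[bool]_k) d (cube r.+1 (child u a))).

(* For x in the unit cube exactly one cube of generation r contains x. *)
Definition level_value k (d : set 'rV[R]_k -> R) (r : nat) (x : 'rV[R]_k) : R :=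
  d (xget set0 [set Q | cubes_at r Q /\ Q x]).

Definition succeeds k (d : set 'rV[R]_k -> R) (x : 'rV[R]_k) : Prop :=
  limn_esup (fun r => (level_value d r x)%:E) = +oo%E.

(* The entries of u are nonnegative on [box r], where the absolute value is
   the inclusion of {0, ..., 2^r - 1} in nat. *)
Definition index_tuple k (s r : nat) (u : 'rV[int]_k) : k.+2.-tuple nat :=
  [tuple of s :: r :: [tuple absz (u ord0 i) | i < k]].

(* Computability of a map N x J -> Q /\ [0, +oo[, where J is the set of pairs
   (r, u) with u in [box r]; a nonnegative rational is output as a numerator
   and a nonzero denominator, not necessarily in lowest terms. *)
Definition computable_ratfun k (f : nat -> nat -> 'rV[int]_k -> rat) : Prop :=
  exists p q : recfun k.+2, forall s r u, box r u ->
    exists a b : nat, [/\ evaluates p (index_tuple s r u) a,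
      evaluates q (index_tuple s r u) b, b != 0%N & f s r u = a%:R / b%:R].

Definition computable_martingale k (d : set 'rV[R]_k -> R) : Prop :=
  martingale d /\
  exists2 dhat : nat -> nat -> 'rV[int]_k -> rat, computable_ratfun dhat &
    forall s r u, box r u ->
      `|ratr (dhat s r u) - d (cube r u)| <= 2 ^- s.

Definition sharp k (E : set 'rV[R]_k) : set 'rV[R]_k :=
  @unit_cube k `&`
  \bigcup_(t in [set: 'rV[int]_k]) [set e + map_mx intr t | e in E].

Definition computable_measure0 k (E : set 'rV[R]_k) : Prop :=
  exists2 d : set 'rV[R]_k -> R, computable_martingale d &
    forall x, sharp E x -> succeeds d x.

Definition slice n m (le_mn : (m <= n)%N) (A : set 'rV[R]_n) (y : 'rV[R]_m) :
    set 'rV[R]_(n - m) :=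
  [set x | A (castmx (erefl 1%N, subnK le_mn) (row_mx x y))].

Definition failure_set n m (le_mn : (m <= n)%N) (E : set 'rV[R]_n)
    (d : set 'rV[R]_(n - m) -> R) : set 'rV[R]_m :=
  [set y | @unit_cube m y /\
    exists2 x, slice le_mn (sharp E) y x & ~ succeeds d x].

End Martingales.

(* Main.v *)
Require Import Defs.
From mathcomp Require Import all_boot all_order all_algebra.
From mathcomp Require Import all_classical all_reals all_analysis.
From mathcomp Require Import ring.

(** Write the points of the unit cube of dimension [k + m] as pairs (x, y). If
    [d1] succeeds at every x in the fibre of E over y, for every y outside a
    set on which [d2] succeeds, then the martingale
    [D (Q1 x Q2) = d1 Q1 + d2 Q2] succeeds at every point (x, y) of E. *)

Set Implicit Arguments.
Unset Strict Implicit.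
Unset Printing Implicit Defensive.

Import Order.TTheory GRing.Theory Num.Theory.

(** * Programs for addition and multiplication *)

Definition rcomp1 j (f : recfun 1) (g : recfun j) : recfun j :=
  RComp f (fun=> g).

Definition rcomp2 j (f : recfun 2) (g h : recfun j) : recfun j :=
  RComp f (fun i : 'I_2 => if i == ord0 then g else h).

Lemma evaluates_comp1 j f (g : recfun j) v a y :
  evaluates g v a -> evaluates f [tuple a] y -> evaluates (rcomp1 f g) v y.
Proof.
by move=> gv fa; exists [tuple a]; split=> // i; rewrite ord1.
Qed.

Lemma evaluates_comp2 j f (g h : recfun j) v a b y :
  evaluates g v a -> evaluates h v b -> evaluates f [tuple a; b] y ->
  evaluates (rcomp2 f g h) v y.
Proof.
move=> gv hv fab; exists [tuple a; b]; split=> // i.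
by case: (unliftP ord0 i) => [i'|] -> //; rewrite ord1.
Qed.

Lemma behead_tuple_cons j (c : nat) (v : j.-tuple nat) :
  behead_tuple [tuple of c :: v] = v :> j.-tuple nat.
Proof. exact: val_inj. Qed.

Lemma evaluates_prec0 j (f : recfun j) g (v : j.-tuple nat) y :
  evaluates f v y -> evaluates (RPrec f g) [tuple of 0%N :: v] y.
Proof. by rewrite /= behead_tuple_cons. Qed.

Lemma evaluates_precS j (f : recfun j) g (v : j.-tuple nat) c z y :
  evaluates (RPrec f g) [tuple of c :: v] z ->
  evaluates g [tuple of c :: z :: v] y ->
  evaluates (RPrec f g) [tuple of c.+1 :: v] y.
Proof.
(* A copy of the recursion inside [evaluates] with the parameters [w] abstracted, so that
   [behead_tuple] of a cons can be replaced by [v] throughout the loop at once. *)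
pose loop (w : j.-tuple nat) := fix loop (c : nat) : nat -> Prop :=
  match c with
  | 0 => evaluates f w
  | c'.+1 => fun y => exists2 z, loop c' z & evaluates g [tuple of c' :: z :: w] y
  end.
have loopE c' y' :
    evaluates (RPrec f g) [tuple of c' :: v] y' = loop v c' y'.
  by rewrite -[in RHS](behead_tuple_cons c' v).
by rewrite !loopE; exists z.
Qed.

Definition radd : recfun 2 :=
  RPrec (RProj ord0 : recfun 1)
        (rcomp1 RSucc (RProj (inord 1) : recfun 3)).

Lemma evaluates_add a b : evaluates radd [tuple a; b] (a + b).
Proof.
elim: a => [|a IH]; first exact: (@evaluates_prec0 1 _ _ [tuple b]).
apply: (@evaluates_precS 1 _ _ [tuple b] _ _ _ IH).
apply: (@evaluates_comp1 _ _ _ _ (a + b)) => //.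
by rewrite /= (tnth_nth 0%N) inordK.
Qed.

(** [RZero] has arity 0, so the constant 0 of arity 1 is its composition with an empty family of
    programs. *)
Definition rmul : recfun 2 :=
  RPrec (RComp RZero (fun=> RProj ord0) : recfun 1)
        (rcomp2 radd (RProj (inord 1)) (RProj (inord 2)) : recfun 3).

Lemma evaluates_mul a b : evaluates rmul [tuple a; b] (a * b).
Proof.
elim: a => [|a IH].
  apply: (@evaluates_prec0 1 _ _ [tuple b]).
  by exists [tuple]; split=> // -[].
apply: (@evaluates_precS 1 _ _ [tuple b] _ _ _ IH).
rewrite mulSn addnC.
apply: evaluates_comp2; last exact: evaluates_add.
- by rewrite /= (tnth_nth 0%N) inordK.
- by rewrite /= (tnth_nth 0%N) inordK.
Qed.

(** * Computable rational functions: change of coordinates and sums *)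

Section ComputableRatfun.
Local Open Scope ring_scope.

Lemma tnth_index_tuple_level k s r (u : 'rV[int]_k) :
  tnth (index_tuple s r u) (lift ord0 ord0) = r.
Proof. by rewrite (tnth_nth 0%N). Qed.

Lemma tnth_index_tuple_entry k s r (u : 'rV[int]_k) i :
  tnth (index_tuple s r u) (lift ord0 (lift ord0 i)) = absz (u ord0 i).
Proof.
rewrite (tnth_nth 0%N) /= -(tnth_nth 0%N [tuple absz (u ord0 i) | i < k]).
exact: tnth_mktuple.
Qed.

(* (s, r, w) |-> (s + 1, r, w o iota); the increment of s pays for the two
   errors that add up in a sum of two approximations. *)
Definition reindex_args k l (iota : 'I_k -> 'I_l) (i : 'I_k.+2) : recfun l.+2 :=
  match unlift ord0 i with
  | None => rcomp1 RSucc (RProj ord0)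
  | Some i' =>
    match unlift ord0 i' with
    | None => RProj (lift ord0 ord0)
    | Some i'' => RProj (lift ord0 (lift ord0 (iota i'')))
    end
  end.

Lemma evaluates_reindex k l (iota : 'I_k -> 'I_l) (p : recfun k.+2) s r
    (w : 'rV[int]_l) y :
  evaluates p (index_tuple s.+1 r (\row_i w 0 (iota i))) y ->
  evaluates (RComp p (reindex_args iota)) (index_tuple s r w) y.
Proof.
move=> py; exists (index_tuple s.+1 r (\row_i w 0 (iota i))); split=> // i.
rewrite /reindex_args; case: (unliftP ord0 i) => [i'|] ->.
  case: (unliftP ord0 i') => [i''|] ->.
    by rewrite tnth_index_tuple_entry mxE /= tnth_index_tuple_entry.
  by rewrite tnth_index_tuple_level /= tnth_index_tuple_level.
by apply: evaluates_comp1.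
Qed.

Lemma computable_ratfun_reindex k l (iota : 'I_k -> 'I_l) f :
  computable_ratfun f ->
  computable_ratfun (fun s r (w : 'rV[int]_l) => f s.+1 r (\row_i w 0 (iota i))).
Proof.
move=> [p [q pqf]].
exists (RComp p (reindex_args iota)), (RComp q (reindex_args iota)) => s r w bw.
have bw' : box r (\row_i w 0 (iota i)) by move=> i; rewrite mxE.
have [a [b [pa qb b0 fE]]] := pqf s.+1 r _ bw'.
by exists a, b; split=> //; exact: evaluates_reindex.
Qed.

(** The fractions a/b and a'/b' are added as (ab' + a'b)/(bb'). No reduction is made, since
    [computable_ratfun] does not ask for lowest terms. *)
Lemma computable_ratfunD k (f g : nat -> nat -> 'rV[int]_k -> rat) :
  computable_ratfun f -> computable_ratfun g ->
  computable_ratfun (fun s r u => f s r u + g s r u).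
Proof.
move=> [p [q pqf]] [p' [q' pqg]].
exists (rcomp2 radd (rcomp2 rmul p q') (rcomp2 rmul p' q)), (rcomp2 rmul q q').
move=> s r u bu.
have [a [b [pa qb b0 ->]]] := pqf s r u bu.
have [a' [b' [pa' qb' b'0 ->]]] := pqg s r u bu.
exists (a * b' + a' * b)%N, (b * b')%N; split.
- apply: evaluates_comp2; last exact: evaluates_add.
    by apply: evaluates_comp2 pa qb' _; exact: evaluates_mul.
  by apply: evaluates_comp2 pa' qb _; exact: evaluates_mul.
- by apply: evaluates_comp2 qb qb' _; exact: evaluates_mul.
- by rewrite muln_eq0 negb_or b0.
- by rewrite natrD !natrM addf_div ?pnatr_eq0.
Qed.

End ComputableRatfun.

(** * Dyadic cubes, level values and success *)

Section Cubes.
Local Open Scope classical_set_scope.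
Local Open Scope ring_scope.
Context {R : realType}.

Lemma cube_nonempty k r (u : 'rV[int]_k) : (cube r u : set 'rV[R]_k) !=set0.
Proof.
exists (\row_i ((u 0 i)%:~R * 2 ^- r)) => i; rewrite !mxE lexx /=.
by rewrite ltr_pM2r ?invr_gt0 ?exprn_gt0// ltr_int ltrDl.
Qed.

(** Membership forces each index to be the floor of 2^r times the coordinate of x. *)
Lemma cube_inj k r (u v : 'rV[int]_k) (x : 'rV[R]_k) :
  cube r u x -> cube r v x -> u = v.
Proof.
have E w : cube r w x -> forall i, w 0 i = Num.floor (x 0 i * 2 ^+ r).
  move=> wx i; apply/esym/floor_def.
  have /andP[h1 h2] := wx i.
  by rewrite -ler_pdivrMr -?ltr_pdivlMr ?exprn_gt0// h1 h2.
by move=> /E ux /E vx; apply/rowP => i; rewrite ux vx.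
Qed.

Lemma unit_cube_cube k r (x : 'rV[R]_k) : unit_cube x ->
  exists2 u, box r u & cube r u x.
Proof.
move=> Ix; exists (\row_i Num.floor (x 0 i * 2 ^+ r)) => i; rewrite !mxE.
  have /andP[x0 x1] := Ix i.
  rewrite floor_ge0 mulr_ge0 ?exprn_ge0//= floor_lt_int.
  by rewrite rmorphXn /= gtr_pMl ?exprn_gt0.
have /andP[h1 h2] := floor_itv (x 0 i * 2 ^+ r).
by rewrite ler_pdivrMr ?ltr_pdivlMr ?exprn_gt0// h1 h2.
Qed.

(** Uniqueness of the cube around x removes the choice made by [xget]. *)
Lemma level_valueE k (d : set 'rV[R]_k -> R) r u x :
  box r u -> cube r u x -> level_value d r x = d (cube r u).
Proof.
move=> bu ux; congr d; apply: xget_unique; first by split=> //; exists u.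
by move=> _ [[v _ <-] vx]; rewrite (cube_inj ux vx).
Qed.

Lemma level_value_ge0 k (d : set 'rV[R]_k -> R) r x :
  martingale d -> unit_cube x -> 0 <= level_value d r x.
Proof.
move=> [d0 _] Ix; have [u bu ux] := unit_cube_cube r Ix.
by rewrite (level_valueE d bu ux); apply: d0; exists r => //; exists u.
Qed.

Lemma limn_esup_le (u v : (\bar R)^nat) :
  (forall i, (u i <= v i)%E) -> (limn_esup u <= limn_esup v)%E.
Proof.
move=> uv; rewrite !limn_esup_lim.
apply: lee_lim; [exact: is_cvg_esups | exact: is_cvg_esups |].
apply: nearW => n; apply: ge_ereal_sup => _ [i ni <-].
by apply: (le_trans (uv i)); apply: ereal_sup_ubound; exists i.
Qed.

(** The dimensions may differ, so that success at one component x can be passed on to the pair (x,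
    y). *)
Lemma succeeds_le k l (d : set 'rV[R]_k -> R) (d' : set 'rV[R]_l -> R) x x' :
  (forall r, level_value d r x <= level_value d' r x') ->
  succeeds d x -> succeeds d' x'.
Proof.
move=> dd' sd; apply/eqP; rewrite -leye_eq -sd.
by apply: limn_esup_le => r; rewrite lee_fin.
Qed.

End Cubes.

(** * The sum of two martingales on a product of cubes *)

Section SumMartingale.
Local Open Scope classical_set_scope.
Local Open Scope ring_scope.
Context {R : realType} {k m : nat}.
Variables (d1 : set 'rV[R]_k -> R) (d2 : set 'rV[R]_m -> R).

(** Taking images under the two projections recovers the factors of a product cube without choosing
    an index for it. *)
Definition sum_martingale (Q : set 'rV[R]_(k + m)) : R :=
  d1 (lsubmx @` Q) + d2 (rsubmx @` Q).

Lemma cube_row_mx r (u : 'rV[int]_(k + m)) (x : 'rV[R]_k) (y : 'rV[R]_m) :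
  cube r u (row_mx x y) <-> cube r (lsubmx u) x /\ cube r (rsubmx u) y.
Proof.
split=> [uxy|[ux vy] i].
  split=> i; rewrite mxE.
    by have := uxy (lshift _ i); rewrite row_mxEl.
  by have := uxy (rshift _ i); rewrite row_mxEr.
case: (split_ordP i) => j ->; rewrite ?row_mxEl ?row_mxEr.
  by have := ux j; rewrite mxE.
by have := vy j; rewrite mxE.
Qed.

Lemma box_row_mx r (u : 'rV[int]_(k + m)) :
  box r u <-> box r (lsubmx u) /\ box r (rsubmx u).
Proof.
split=> [bu|[bl br] i]; first by split=> i; rewrite mxE.
case: (split_ordP i) => j ->.
  by have := bl j; rewrite mxE.
by have := br j; rewrite mxE.
Qed.

(** A product projects onto the whole of its first factor because the second one is nonempty. *)
Lemma lsubmx_cube r (u : 'rV[int]_(k + m)) :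
  lsubmx @` (cube r u : set 'rV[R]_(k + m)) = cube r (lsubmx u).
Proof.
apply/seteqP; split=> [_ [z uz <-]|x ux].
  by move: uz; rewrite -{1}[z]hsubmxK => /cube_row_mx[].
have [y uy] := @cube_nonempty R _ r (rsubmx u).
by exists (row_mx x y); [exact/cube_row_mx | rewrite row_mxKl].
Qed.

Lemma rsubmx_cube r (u : 'rV[int]_(k + m)) :
  rsubmx @` (cube r u : set 'rV[R]_(k + m)) = cube r (rsubmx u).
Proof.
apply/seteqP; split=> [_ [z uz <-]|y uy].
  by move: uz; rewrite -{1}[z]hsubmxK => /cube_row_mx[].
have [x ux] := @cube_nonempty R _ r (lsubmx u).
by exists (row_mx x y); [exact/cube_row_mx | rewrite row_mxKr].
Qed.

Lemma sum_martingale_cube r u :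
  sum_martingale (cube r u) = d1 (cube r (lsubmx u)) + d2 (cube r (rsubmx u)).
Proof. by rewrite /sum_martingale lsubmx_cube rsubmx_cube. Qed.

(** Each F a occurs once for every b, that is 2^m times, which turns the weight 2^-(k + m) into
    2^-k; symmetrically for G. *)
Lemma sum_rowb (F : 'rV[bool]_k -> R) (G : 'rV[bool]_m -> R) :
  2 ^- (k + m) * \sum_(a : 'rV[bool]_(k + m)) (F (lsubmx a) + G (rsubmx a)) =
  2 ^- k * (\sum_a F a) + 2 ^- m * (\sum_b G b).
Proof.
rewrite (reindex (fun p : 'rV_k * 'rV_m => row_mx p.1 p.2)) /=; last first.
  exists (fun a => (lsubmx a, rsubmx a)) => [[a b] _|a _] /=.
    by rewrite row_mxKl row_mxKr.
  by rewrite hsubmxK.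
under eq_bigr do rewrite row_mxKl row_mxKr.
rewrite -(pair_bigA _ (fun a b => F a + G b)) /=.
under eq_bigr do rewrite big_split /= sumr_const card_mx card_bool mul1n.
rewrite big_split /= sumr_const card_mx card_bool mul1n.
rewrite sumrMnl -[_ *+ 2 ^ m]mulr_natr -[_ *+ 2 ^ k]mulr_natr !natrX exprD.
have k0 : (2 ^+ k : R) != 0 by rewrite expf_neq0 ?pnatr_eq0.
have m0 : (2 ^+ m : R) != 0 by rewrite expf_neq0 ?pnatr_eq0.
by field; rewrite k0 m0.
Qed.

Lemma martingale_sum :
  martingale d1 -> martingale d2 -> martingale sum_martingale.
Proof.
move=> [d1_ge0 d1E] [d2_ge0 d2E]; split=> [Q [r _ [u bu <-]]|r u bu];
    have /box_row_mx[bl br] := bu; rewrite sum_martingale_cube.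
  apply: addr_ge0; [apply: d1_ge0 | apply: d2_ge0]; exists r => //.
    by exists (lsubmx u).
  by exists (rsubmx u).
rewrite d1E// d2E//.
rewrite -(sum_rowb (fun a => d1 (cube r.+1 (child (lsubmx u) a)))
                   (fun b => d2 (cube r.+1 (child (rsubmx u) b)))).
congr (_ * _); apply: eq_bigr => a _; rewrite sum_martingale_cube.
(* The two halves of a child of u are children of the two halves of u. *)
by congr (d1 (cube _ _) + d2 (cube _ _)); apply/rowP => i; rewrite !mxE.
Qed.

Lemma computable_martingale_sum :
  computable_martingale d1 -> computable_martingale d2 ->
  computable_martingale sum_martingale.
Proof.
move=> [md1 [f1 cf1 f1d]] [md2 [f2 cf2 f2d]].
split; first exact: martingale_sum.
(* Precision s + 1 in each term gives total error 2 * 2^-(s + 1) = 2^-s. The halves of u are spelled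
   as rows to match [computable_ratfun_reindex]. *)
exists (fun s r u => f1 s.+1 r (\row_i u 0 (lshift m i)) +
                     f2 s.+1 r (\row_i u 0 (rshift k i))).
  by apply: computable_ratfunD; exact: computable_ratfun_reindex.
move=> s r u bu; have /box_row_mx[bl br] := bu.
have -> : \row_i u 0 (lshift m i) = lsubmx u by apply/rowP => i; rewrite !mxE.
have -> : \row_i u 0 (rshift k i) = rsubmx u by apply/rowP => i; rewrite !mxE.
rewrite sum_martingale_cube rmorphD /= opprD addrACA.
apply: (le_trans (ler_normD _ _)).
have -> : 2 ^- s = 2 ^- s.+1 + 2 ^- s.+1 :> R.
  have s0 : (2 ^+ s : R) != 0 by rewrite expf_neq0 ?pnatr_eq0.
  by rewrite exprS; field.
by apply: lerD; [exact: f1d | exact: f2d].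
Qed.

Lemma unit_cube_row_mx (x : 'rV[R]_k) (y : 'rV[R]_m) :
  unit_cube (row_mx x y) <-> unit_cube x /\ unit_cube y.
Proof.
split=> [Ixy|[Ix Iy] i].
  split=> i.
    by have := Ixy (lshift _ i); rewrite row_mxEl.
  by have := Ixy (rshift _ i); rewrite row_mxEr.
by case: (split_ordP i) => j ->; rewrite ?row_mxEl ?row_mxEr.
Qed.

Lemma level_value_sum r (x : 'rV[R]_k) (y : 'rV[R]_m) :
  unit_cube x -> unit_cube y ->
  level_value sum_martingale r (row_mx x y) =
  level_value d1 r x + level_value d2 r y.
Proof.
move=> Ix Iy.
have [u bu uxy] : exists2 u, box r u & cube r u (row_mx x y).
  by apply: unit_cube_cube; exact/unit_cube_row_mx.
have /box_row_mx[bl br] := bu; have /cube_row_mx[ux uy] := uxy.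
by rewrite (level_valueE _ bu uxy) (level_valueE d1 bl ux)
           (level_valueE d2 br uy) sum_martingale_cube.
Qed.

(** Level values are nonnegative, so the sum dominates each of its two terms. *)
Lemma succeeds_sum (x : 'rV[R]_k) (y : 'rV[R]_m) :
  martingale d1 -> martingale d2 -> unit_cube (row_mx x y) ->
  succeeds d1 x \/ succeeds d2 y -> succeeds sum_martingale (row_mx x y).
Proof.
move=> md1 md2 /unit_cube_row_mx[Ix Iy].
case; apply: succeeds_le => r; rewrite level_value_sum//.
  by rewrite lerDl level_value_ge0.
by rewrite lerDr level_value_ge0.
Qed.

End SumMartingale.

(** * From fibres to the whole set *)

Section Transport.
Local Open Scope classical_set_scope.
Local Open Scope ring_scope.
Context {R : realType}.

(** The translation by 0 suffices. This is needed because a null set is covered through its [sharp],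
    while exceptional points are found in the set itself. *)
Lemma sub_sharp k (E : set 'rV[R]_k) : E `<=` @unit_cube R k -> E `<=` sharp E.
Proof.
move=> EI x Ex; split; first exact: EI.
by exists 0 => //; exists x => //; rewrite raddf0 addr0.
Qed.

(* Stating the cast for an arbitrary [k] lets [e] be destructed, which is
   impossible for [n - m + m = n]. *)
Lemma computable_measure0_fibers k m n (e : (k + m)%N = n)
    (E : set 'rV[R]_n) (d : set 'rV[R]_k -> R) :
  computable_martingale d ->
  computable_measure0 [set y | @unit_cube R m y /\
    exists2 x, sharp E (castmx (erefl 1%N, e) (row_mx x y)) &
               ~ succeeds d x] ->
  computable_measure0 E.
Proof.
case: n / e E => E cd [d' cd' d'N].
exists (sum_martingale d d'); first exact: computable_martingale_sum.
move=> z Ez; rewrite -[z]hsubmxK; have [Iz _] := Ez.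
have Ilr : unit_cube (row_mx (lsubmx z) (rsubmx z)) by rewrite hsubmxK.
apply: (succeeds_sum _ _ Ilr); [exact: cd.1 | exact: cd'.1 |].
have [?|nd] := pselect (succeeds d (lsubmx z)); first by left.
(* Here [d] fails at the left half of z, which therefore witnesses that the right half is
   exceptional, where [d'] succeeds. *)
right; apply: d'N; apply: sub_sharp; first by move=> y [].
split; first by have /unit_cube_row_mx[] := Ilr.
by exists (lsubmx z) => //; rewrite castmx_id hsubmxK.
Qed.

End Transport.

Theorem theorem12 (R : realType) (n m : nat) (m_gt0 : (1 <= m)%N)
    (lt_mn : (m < n)%N) (E : set 'rV[R]_n)
    (hE : exists2 d : set 'rV[R]_(n - m) -> R, computable_martingale d &
       computable_measure0 (failure_set (ltnW lt_mn) E d)) :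
  computable_measure0 E.
(* [failure_set] and [slice] unfold to the set in that lemma, with k = n - m and the equation
   [subnK]. *)
Proof. by case: hE => d cd; exact: computable_measure0_fibers. Qed.
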